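(* Let $f:M\to N$ be a morphism of $\mathbb B$-modules. (i) $\mathrm{Ker}_pf$, endowed with its canonical involution, is isomorphic as an object of $\mathrm{Bmod}^{\mathfrak s}$ to $\mathrm{Ker}(\mathfrak sf)$. (ii) $\mathrm{Coker}_pf$, endowed with its canonical involution, is isomorphic as an object of $\mathrm{Bmod}^{\mathfrak s}$ to $\mathrm{Coker}(\mathfrak sf)$.
   Context: $\mathbb B=\{0,1\}$ is the Boolean semifield ($1+1=1$). A $\mathbb B$-module is a commutative monoid $(M,+,0)$ with $x+x=x$ for all $x$; morphisms are the monoid homomorphisms; the category is $\mathrm{Bmod}$. $\mathrm{Bmod}^{\mathfrak s}$ is the category of $\mathbb B$-modules endowed with an involution $\sigma$ (an endomorphism with $\sigma^2=\mathrm{id}$), with morphisms the $\mathbb B$-module morphisms commuting with $\sigma$; $M^\sigma$ denotes the fixed points. For $f:M\to N$ in $\mathrm{Bmod}$, $\mathrm{Ker}_pf\subset M\times M$ is the equalizer of $f\circ p_1$ and $f\circ p_2$, where $p_1,p_2:M\times M\to M$ are the projections; its canonical involution is the restriction of $(x,y)\mapsto(y,x)$. $\mathrm{Coker}_pf$ is the coequalizer in $\mathrm{Bmod}$ of $s_1\circ f,s_2\circ f:M\to N\oplus N=N\times N$, with $s_1(x)=(x,0)$ and $s_2(x)=(0,x)$; its canonical involution is the one induced by $(x,y)\mapsto(y,x)$ on $N\times N$. $\mathfrak sM:=M\times M$ with involution $(x,y)\mapsto(y,x)$, and $\mathfrak sf:\mathfrak sM\to\mathfrak sN$ is $(x,y)\mapsto(f(x),f(y))$.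 For $h:L\to L'$ in $\mathrm{Bmod}^{\mathfrak s}$, $\mathrm{Ker}(h):=h^{-1}(L'^\sigma)$ and $\mathrm{Coker}(h):=L'/\!\sim$, where $b\sim b'$ iff $g(b)=g(b')$ for every object $X$ and every morphism $g:L'\to X$ of $\mathrm{Bmod}^{\mathfrak s}$ with $\mathrm{Range}(h)\subset\mathrm{Ker}(g)$. *)

(* Defs.v *)
From HB Require Import structures.
From mathcomp Require Import all_boot all_algebra.
From mathcomp Require Import boolp.

Set Implicit Arguments.
Unset Strict Implicit.
Unset Printing Implicit Defensive.

Import GRing.Theory.
Local Open Scope ring_scope.
Local Open Scope quotient_scope.

(* bmodType is the category Bmod; its morphisms are {additive M -> N}, which
   between nmodTypes are exactly the maps preserving 0 and +. bmodSType is
   Bmod^s, with morphisms {bmodS L -> L'}. *)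

HB.mixin Record Nmodule_isIdempotent M of GRing.Nmodule M := {
  addrr : forall x : M, x + x = x
}.

#[short(type="bmodType")]
HB.structure Definition BModule :=
  {M of GRing.Nmodule M & Nmodule_isIdempotent M}.

HB.mixin Record BModule_hasInvolution M of BModule M := {
  sigma : M -> M;
  sigma_nmod_morphism : nmod_morphism sigma;
  sigmaK : involutive sigma
}.

#[short(type="bmodSType")]
HB.structure Definition BModuleS := {M of BModule M & BModule_hasInvolution M}.

HB.instance Definition _ (L : bmodSType) :=
  GRing.isNmodMorphism.Build L L (@sigma L) (@sigma_nmod_morphism L).

HB.mixin Record isEquivariant (L L' : bmodSType) (h : L -> L') := {
  equivariant : forall x, h (sigma x) = sigma (h x)
}.

#[short(type="bmodSMorphism")]
HB.structure Definition BModuleSMorphism (L L' : bmodSType) :=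
  {h of @GRing.Additive L L' h & @isEquivariant L L' h}.

Notation "{ 'bmodS' L -> L' }" := (bmodSMorphism L%type L'%type)
  (at level 0, L at level 98, L' at level 99,
   format "{ 'bmodS'  L  ->  L' }") : type_scope.

Definition isomS (L L' : bmodSType) : Prop :=
  exists (u : {bmodS L -> L'}) (v : {bmodS L' -> L}), cancel u v /\ cancel v u.

Definition is_equalizer (E A B : bmodType) (u v : {additive A -> B})
    (e : {additive E -> A}) : Prop :=
  (forall x, u (e x) = v (e x)) /\
  forall (X : bmodType) (g : {additive X -> A}),
    (forall x, u (g x) = v (g x)) ->
    (exists k : {additive X -> E}, forall x, e (k x) = g x) /\
    (forall k k' : {additive X -> E},
       (forall x, e (k x) = g x) -> (forall x, e (k' x) = g x) -> k =1 k').

Definition is_coequalizer (A B Q : bmodType) (u v : {additive A -> B})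
    (q : {additive B -> Q}) : Prop :=
  (forall x, q (u x) = q (v x)) /\
  forall (X : bmodType) (g : {additive B -> X}),
    (forall x, g (u x) = g (v x)) ->
    (exists k : {additive Q -> X}, forall y, k (q y) = g y) /\
    (forall k k' : {additive Q -> X},
       (forall y, k (q y) = g y) -> (forall y, k' (q y) = g y) -> k =1 k').

Fact pair_addrr (M N : bmodType) (x : M * N) : x + x = x.
Proof. by case: x => a b; congr pair; rewrite addrr. Qed.

HB.instance Definition _ (M N : bmodType) :=
  Nmodule_isIdempotent.Build (M * N)%type (@pair_addrr M N).

Definition swap (M : Type) (x : M * M) : M * M := (x.2, x.1).

Fact swap_nmod_morphism (M : bmodType) : nmod_morphism (@swap M).
Proof. by []. Qed.

HB.instance Definition _ (M : bmodType) :=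
  GRing.isNmodMorphism.Build _ _ (@swap M) (@swap_nmod_morphism M).

Fact swapK (M : Type) : involutive (@swap M).
Proof. by case. Qed.

Definition s1 (N : bmodType) (x : N) : N * N := (x, 0).
Definition s2 (N : bmodType) (x : N) : N * N := (0, x).

Fact s1_nmod_morphism (N : bmodType) : nmod_morphism (@s1 N).
Proof. by split=> // x y; congr pair; rewrite /= addr0. Qed.

Fact s2_nmod_morphism (N : bmodType) : nmod_morphism (@s2 N).
Proof. by split=> // x y; congr pair; rewrite /= addr0. Qed.

HB.instance Definition _ (N : bmodType) :=
  GRing.isNmodMorphism.Build _ _ (@s1 N) (@s1_nmod_morphism N).
HB.instance Definition _ (N : bmodType) :=
  GRing.isNmodMorphism.Build _ _ (@s2 N) (@s2_nmod_morphism N).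

Fact fst_nmod_morphism (M : bmodType) : nmod_morphism (@fst M M).
Proof. by []. Qed.
Fact snd_nmod_morphism (M : bmodType) : nmod_morphism (@snd M M).
Proof. by []. Qed.

(* The library makes the projections additive only for zmodTypes. *)
Definition p1 (M : bmodType) (x : M * M) : M := x.1.
Definition p2 (M : bmodType) (x : M * M) : M := x.2.
HB.instance Definition _ (M : bmodType) :=
  GRing.isNmodMorphism.Build _ _ (@p1 M) (@fst_nmod_morphism M).
HB.instance Definition _ (M : bmodType) :=
  GRing.isNmodMorphism.Build _ _ (@p2 M) (@snd_nmod_morphism M).

(* dup and dup_map are the functor s. An alias of M * M is used so that the
   swap does not become the involution of every product. *)

Definition dup (M : Type) : Type := (M * M)%type.

HB.instance Definition _ (M : bmodType) := BModule.on (dup M).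
HB.instance Definition _ (M : bmodType) :=
  BModule_hasInvolution.Build (dup M) (@swap_nmod_morphism M) (@swapK M).

Definition dup_map (M N : Type) (f : M -> N) (x : dup M) : dup N :=
  (f x.1, f x.2).

Section DupMap.
Variables (M N : bmodType) (f : {additive M -> N}).

Fact dup_map_nmod_morphism : nmod_morphism (dup_map f).
Proof.
split=> [|x y]; rewrite /dup_map /= ?raddf0 //.
by congr pair; rewrite raddfD.
Qed.

Fact dup_map_equivariant (x : dup M) : dup_map f (sigma x) = sigma (dup_map f x).
Proof. by []. Qed.

HB.instance Definition _ :=
  GRing.isNmodMorphism.Build (dup M) (dup N) (dup_map f) dup_map_nmod_morphism.
HB.instance Definition _ :=
  isEquivariant.Build (dup M) (dup N) (dup_map f) dup_map_equivariant.

End DupMap.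

Record congruence (L : bmodType) := Congruence {
  crel :> L -> L -> Prop;
  crel_refl : forall x, crel x x;
  crel_sym : forall x y, crel x y -> crel y x;
  crel_trans : forall y x z, crel x y -> crel y z -> crel x z;
  crel_add : forall x x' y y', crel x x' -> crel y y' -> crel (x + y) (x' + y')
}.

Section Quotient.
Variables (L : bmodType) (R : congruence L).

Definition crelb (x y : L) : bool := `[< R x y >].

Fact crelb_refl : reflexive crelb.
Proof. by move=> x; apply/asboolP/crel_refl. Qed.
Fact crelb_sym : symmetric crelb.
Proof. by move=> x y; apply/asboolP/asboolP; apply: crel_sym. Qed.
Fact crelb_trans : transitive crelb.
Proof.
by move=> y x z /asboolP xy /asboolP yz; apply/asboolP/(crel_trans xy yz).
Qed.

Canonical crelb_equiv := EquivRel crelb crelb_refl crelb_sym crelb_trans.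

Definition quot : Type := {eq_quot crelb_equiv}.
HB.instance Definition _ := Choice.on quot.

Definition qpi (x : L) : quot := \pi_{eq_quot crelb_equiv} x.
Definition qrepr (a : quot) : L := repr (a : {eq_quot crelb_equiv}).

Lemma qreprK : cancel qrepr qpi.
Proof. by move=> a; rewrite /qpi /qrepr reprK. Qed.

Lemma qpiP x y : qpi x = qpi y <-> R x y.
Proof.
split=> [/eqmodP/asboolP//|Rxy].
by apply/eqmodP/asboolP.
Qed.

Lemma qrepr_qpi x : R (qrepr (qpi x)) x.
Proof. by apply/qpiP; rewrite qreprK. Qed.

Definition qadd (a b : quot) : quot := qpi (qrepr a + qrepr b).

Lemma qpiD x y : qpi (x + y) = qadd (qpi x) (qpi y).
Proof. by apply/qpiP/crel_sym/crel_add; apply: qrepr_qpi. Qed.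

Fact qaddA : associative qadd.
Proof.
move=> a b c; rewrite -[a]qreprK -[b]qreprK -[c]qreprK.
by rewrite -!qpiD addrA.
Qed.
Fact qaddC : commutative qadd.
Proof. by move=> a b; rewrite /qadd addrC. Qed.
Fact qadd0 : left_id (qpi 0) qadd.
Proof. by move=> a; rewrite -[a]qreprK -qpiD add0r. Qed.

HB.instance Definition _ := GRing.isNmodule.Build quot qaddA qaddC qadd0.

Fact qaddrr (a : quot) : a + a = a.
Proof. exact: (etrans (congr1 qpi (addrr (qrepr a))) (qreprK a)). Qed.

HB.instance Definition _ := Nmodule_isIdempotent.Build quot qaddrr.

Fact qpi_nmod_morphism : nmod_morphism qpi.
Proof. by split=> // x y; rewrite qpiD. Qed.

HB.instance Definition _ := GRing.isNmodMorphism.Build L quot qpi qpi_nmod_morphism.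

End Quotient.

Record congruenceS (L : bmodSType) := CongruenceS {
  crelS :> congruence L;
  crel_sigma : forall x y, crelS x y -> crelS (sigma x) (sigma y)
}.

Definition quotS (L : bmodSType) (R : congruenceS L) : Type := quot R.

Section QuotientS.
Variables (L : bmodSType) (R : congruenceS L).

HB.instance Definition _ := BModule.on (quotS R).

Definition qpiS (x : L) : quotS R := qpi R x.

Definition qsigma (a : quotS R) : quotS R := qpiS (sigma (qrepr a)).

Lemma qpi_sigma x : qpiS (sigma x) = qsigma (qpiS x).
Proof. by apply/qpiP/crel_sym/crel_sigma/qrepr_qpi. Qed.

Fact qsigma_nmod_morphism : nmod_morphism qsigma.
Proof.
have q0 : qpiS 0 = 0 by [].
have qD x y : qpiS (x + y) = qpiS x + qpiS y by exact: (qpiD R).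
split=> [|a b]; first by rewrite -q0 -qpi_sigma raddf0.
rewrite -[a](@qreprK _ R) -[b](@qreprK _ R) -!/(qpiS _) -qD.
by rewrite -!qpi_sigma raddfD qD.
Qed.

Fact qsigmaK : involutive qsigma.
Proof.
by move=> a; rewrite -[a](@qreprK _ R) -!/(qpiS _) -!qpi_sigma sigmaK.
Qed.

HB.instance Definition _ :=
  BModule_hasInvolution.Build (quotS R) qsigma_nmod_morphism qsigmaK.

Fact qpiS_nmod_morphism : nmod_morphism qpiS.
Proof. exact: qpi_nmod_morphism. Qed.

HB.instance Definition _ :=
  GRing.isNmodMorphism.Build L (quotS R) qpiS qpiS_nmod_morphism.
HB.instance Definition _ := isEquivariant.Build L (quotS R) qpiS qpi_sigma.

End QuotientS.

Section Kerp.
Variables (M N : bmodType) (f : {additive M -> N}).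

(* The equalizer of f \o p1 and f \o p2, see kerp_is_equalizer. *)
Definition kerp_pred : {pred M * M} := fun x => f x.1 == f x.2.

Definition Kerp : Type := {x : M * M | x \in kerp_pred}.

Fact kerp_closed : addr_closed kerp_pred.
Proof.
split=> [|x y]; rewrite !unfold_in //= => /eqP ex /eqP ey.
by rewrite !raddfD ex ey.
Qed.

HB.instance Definition _ := SubChoice.on Kerp.
HB.instance Definition _ :=
  GRing.SubChoice_isSubNmodule.Build _ kerp_pred Kerp kerp_closed.

Fact kerp_addrr (x : Kerp) : x + x = x.
Proof. by apply: val_inj; rewrite raddfD addrr. Qed.

HB.instance Definition _ := Nmodule_isIdempotent.Build Kerp kerp_addrr.

Fact kerp_swap_subproof (x : Kerp) : swap (val x) \in kerp_pred.
Proof. by have := valP x; rewrite !unfold_in eq_sym. Qed.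

Definition kerp_swap (x : Kerp) : Kerp := Sub (swap (val x)) (kerp_swap_subproof x).

Fact kerp_swap_nmod_morphism : nmod_morphism kerp_swap.
Proof.
split=> [|x y]; apply: val_inj; first by rewrite SubK raddf0.
by rewrite [RHS]raddfD !SubK !raddfD.
Qed.

Fact kerp_swapK : involutive kerp_swap.
Proof. by move=> x; apply: val_inj; rewrite !SubK swapK. Qed.

HB.instance Definition _ :=
  BModule_hasInvolution.Build Kerp kerp_swap_nmod_morphism kerp_swapK.

Lemma val_sigma_kerp (x : Kerp) : val (sigma x) = swap (val x).
Proof. by rewrite SubK. Qed.

Lemma kerp_is_equalizer :
  @is_equalizer Kerp _ _ (f \o @p1 M) (f \o @p2 M) (val : Kerp -> M * M).
Proof.
split=> [x|X g eg]; first exact/eqP/(valP x).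
have gP x : g x \in kerp_pred by apply/eqP/eg.
pose k x : Kerp := Sub (g x) (gP x).
have kM : nmod_morphism k.
  split=> [|x y]; apply: val_inj; first by rewrite /k SubK !raddf0.
  by rewrite [RHS]raddfD /k !SubK raddfD.
pose kA := GRing.isNmodMorphism.Build _ _ k kM.
pose K : {additive X -> Kerp} := HB.pack k kA.
split; first by exists K.
by move=> u v eu ev x; apply: val_inj; exact: etrans (eu x) (esym (ev x)).
Qed.

End Kerp.

(* Coker_p f is built as the quotient of N * N by the smallest congruence that
   identifies s1 (f x) with s2 (f x) for all x; cokerp_is_coequalizer proves
   that this is the coequalizer, and sigma_cokerp_proj that its involution is
   the one induced by the swap. *)

Section Cokerp.
Variables (M N : bmodType) (f : {additive M -> N}).

Definition cokerp_rel (b b' : dup N) : Prop :=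
  forall R : congruence (N * N)%type,
    (forall x, R (s1 (f x)) (s2 (f x))) -> R b b'.

Fact cokerp_rel_refl x : cokerp_rel x x.
Proof. by move=> R _; apply: crel_refl. Qed.
Fact cokerp_rel_sym x y : cokerp_rel x y -> cokerp_rel y x.
Proof. by move=> xy R fR; apply: crel_sym; apply: xy. Qed.
Fact cokerp_rel_trans y x z :
  cokerp_rel x y -> cokerp_rel y z -> cokerp_rel x z.
Proof. by move=> xy yz R fR; apply: (crel_trans (xy R fR)); apply: yz. Qed.
Fact cokerp_rel_add x x' y y' :
  cokerp_rel x x' -> cokerp_rel y y' -> cokerp_rel (x + y) (x' + y').
Proof. by move=> xx yy R fR; apply: crel_add; [apply: xx|apply: yy]. Qed.

Definition cokerp_congruence : congruence (dup N) :=
  Congruence cokerp_rel_refl cokerp_rel_sym cokerp_rel_trans cokerp_rel_add.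

Fact cokerp_rel_sigma x y :
  cokerp_congruence x y -> cokerp_congruence (sigma x) (sigma y).
Proof.
move=> xy R fR.
pose T (a b : N * N) := R (swap a) (swap b).
have Tr a : T a a by apply: crel_refl.
have Ts a b : T a b -> T b a by apply: crel_sym.
have Tt b a c : T a b -> T b c -> T a c by apply: crel_trans.
have Ta a a' b b' : T a a' -> T b b' -> T (a + b) (a' + b') by apply: crel_add.
by apply: (xy (Congruence Tr Ts Tt Ta)) => z; apply/crel_sym/fR.
Qed.

Definition cokerp_congruenceS : congruenceS (dup N) :=
  CongruenceS cokerp_rel_sigma.

Definition Cokerp : Type := quotS cokerp_congruenceS.
HB.instance Definition _ := BModuleS.on Cokerp.

Definition cokerp_proj (y : N * N) : Cokerp := qpiS cokerp_congruenceS y.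

Fact cokerp_proj_nmod_morphism : nmod_morphism cokerp_proj.
Proof. exact: qpi_nmod_morphism. Qed.

HB.instance Definition _ :=
  GRing.isNmodMorphism.Build _ Cokerp cokerp_proj cokerp_proj_nmod_morphism.

Lemma sigma_cokerp_proj (y : N * N) :
  sigma (cokerp_proj y) = cokerp_proj (swap y).
Proof. by rewrite /cokerp_proj -(@equivariant _ _ (qpiS cokerp_congruenceS)). Qed.

Lemma cokerp_is_coequalizer :
  @is_coequalizer _ _ Cokerp (@s1 N \o f) (@s2 N \o f) cokerp_proj.
Proof.
split=> [x|X g eg]; first by apply/qpiP => R; apply.
pose T (a b : N * N) := g a = g b.
have Tr a : T a a by [].
have Ts a b : T a b -> T b a by exact: esym.
have Tt b a c : T a b -> T b c -> T a c by exact: etrans.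
have Ta a a' b b' : T a a' -> T b b' -> T (a + b) (a' + b').
  by rewrite /T !raddfD => -> ->.
pose k (a : Cokerp) := g (qrepr a).
have kE y : k (cokerp_proj y) = g y.
  exact: (qrepr_qpi cokerp_congruence y (Congruence Tr Ts Tt Ta) eg).
have kM : nmod_morphism k.
  split=> [|a b]; first by rewrite -(raddf0 cokerp_proj) kE raddf0.
  rewrite -[a](@qreprK _ cokerp_congruence) -[b](@qreprK _ cokerp_congruence).
  by rewrite -!/(cokerp_proj _) -(raddfD cokerp_proj) !kE raddfD.
pose kA := GRing.isNmodMorphism.Build _ _ k kM.
pose K : {additive Cokerp -> X} := HB.pack k kA.
split; first by exists K.
move=> u v eu ev a; rewrite -[a](@qreprK _ cokerp_congruence).
exact: etrans (eu (qrepr a)) (esym (ev (qrepr a))).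
Qed.

End Cokerp.

Section Ker.
Variables (L L' : bmodSType) (h : {bmodS L -> L'}).

(* h^-1 of the fixed points of L' *)
Definition ker_pred : {pred L} := fun x => sigma (h x) == h x.

Definition Ker : Type := {x : L | x \in ker_pred}.

Fact ker_closed : addr_closed ker_pred.
Proof.
split=> [|x y]; rewrite !unfold_in ?raddf0 //= => /eqP ex /eqP ey.
by rewrite (raddfD h) /= (raddfD sigma) /= ex ey.
Qed.

HB.instance Definition _ := SubChoice.on Ker.
HB.instance Definition _ :=
  GRing.SubChoice_isSubNmodule.Build _ ker_pred Ker ker_closed.

Fact ker_addrr (x : Ker) : x + x = x.
Proof. by apply: val_inj; rewrite raddfD addrr. Qed.

HB.instance Definition _ := Nmodule_isIdempotent.Build Ker ker_addrr.

Fact ker_sigma_subproof (x : Ker) : sigma (val x) \in ker_pred.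
Proof. by have := valP x; rewrite !unfold_in equivariant => /eqP E; rewrite !E. Qed.

Definition ker_sigma (x : Ker) : Ker := Sub (sigma (val x)) (ker_sigma_subproof x).

Fact ker_sigma_nmod_morphism : nmod_morphism ker_sigma.
Proof.
split=> [|x y]; apply: val_inj; first by rewrite SubK !raddf0.
by rewrite [RHS]raddfD !SubK !raddfD.
Qed.

Fact ker_sigmaK : involutive ker_sigma.
Proof. by move=> x; apply: val_inj; rewrite !SubK sigmaK. Qed.

HB.instance Definition _ :=
  BModule_hasInvolution.Build Ker ker_sigma_nmod_morphism ker_sigmaK.

End Ker.

Section Coker.
Variables (L L' : bmodSType) (h : {bmodS L -> L'}).

(* The hypothesis on g says that the range of h is contained in Ker(g). *)
Definition coker_rel (b b' : L') : Prop :=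
  forall (X : bmodSType) (g : {bmodS L' -> X}),
    (forall x : L, h x \in ker_pred g) -> g b = g b'.

Fact coker_rel_refl x : coker_rel x x.
Proof. by []. Qed.
Fact coker_rel_sym x y : coker_rel x y -> coker_rel y x.
Proof. by move=> xy X g hg; rewrite (xy X g). Qed.
Fact coker_rel_trans y x z :
  coker_rel x y -> coker_rel y z -> coker_rel x z.
Proof. by move=> xy yz X g hg; rewrite (xy X g) ?(yz X g). Qed.
Fact coker_rel_add x x' y y' :
  coker_rel x x' -> coker_rel y y' -> coker_rel (x + y) (x' + y').
Proof. by move=> xx yy X g hg; rewrite !raddfD /= (xx X g) ?(yy X g). Qed.

Definition coker_congruence : congruence L' :=
  Congruence coker_rel_refl coker_rel_sym coker_rel_trans coker_rel_add.

Fact coker_rel_sigma x y :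
  coker_congruence x y -> coker_congruence (sigma x) (sigma y).
Proof. by move=> xy X g hg; rewrite !equivariant (xy X g). Qed.

Definition coker_congruenceS : congruenceS L' := CongruenceS coker_rel_sigma.

Definition Coker : Type := quotS coker_congruenceS.
HB.instance Definition _ := BModuleS.on Coker.

End Coker.

(* Main.v *)
From HB Require Import structures.
Require Import Defs.
From mathcomp Require Import all_boot all_algebra.

Import GRing.Theory.
Local Open Scope ring_scope.

(** The point (x, y) of M * M lies in Ker (s f) iff (f x, f y) is fixed by the
    swap, i.e. iff f x = f y, so the two kernels coincide. The two cokernels are
    quotients of N * N by the same congruence: an equivariant g maps (f x, f 0)
    to a fixed point iff g (f x, 0) = g (0, f x), so the congruence of
    Coker (s f) contains the generators of that of Coker_p f; conversely the
    projection onto Coker_p f is an admissible test morphism g. *)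

(** The inverse of a bijective morphism is itself a morphism: injectivity of [v]'s inverse [u]
    transports additivity and equivariance to [v]. *)
Lemma isomS_of_cancel (L L' : bmodSType) (u : L -> L') (v : L' -> L) :
  nmod_morphism u -> (forall x, u (sigma x) = sigma (u x)) ->
  cancel u v -> cancel v u -> isomS L L'.
Proof.
move=> uM uS uK vK.
have vM : nmod_morphism v.
  case: uM => u0 uD; split=> [|x y]; first by rewrite -u0 uK.
  by apply: (can_inj uK); rewrite uD !vK.
have vS x : v (sigma x) = sigma (v x) by apply: (can_inj uK); rewrite uS !vK.
pose uA := GRing.isNmodMorphism.Build _ _ u uM.
pose uE := isEquivariant.Build _ _ u uS.
pose vA := GRing.isNmodMorphism.Build _ _ v vM.
pose vE := isEquivariant.Build _ _ v vS.
pose U : {bmodS L -> L'} := HB.pack u uA uE.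
pose V : {bmodS L' -> L} := HB.pack v vA vE.
by exists U, V.
Qed.

Lemma isomS_quotS (L : bmodSType) (R R' : congruenceS L) :
  (forall x y, R x y <-> R' x y) -> isomS (quotS R) (quotS R').
Proof.
move=> RR'.
pose u (a : quotS R) : quotS R' := qpiS R' (qrepr a).
pose v (a : quotS R') : quotS R := qpiS R (qrepr a).
(* The chosen representative of the class of [x] is only [R]-related to [x]; [RR'] makes its
   [R']-class that of [x]. *)
have uE x : u (qpiS R x) = qpiS R' x by apply/qpiP/RR'/qrepr_qpi.
have vE x : v (qpiS R' x) = qpiS R x by apply/qpiP/RR'/qrepr_qpi.
have piK (S : congruenceS L) (a : quotS S) : qpiS S (qrepr a) = a.
  exact: qreprK.
apply: (@isomS_of_cancel _ _ u v) => [|a|a|a].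
- split=> [|a b]; first by rewrite -(raddf0 (qpiS R)) uE raddf0.
  by rewrite -[a]piK -[b]piK -raddfD !uE raddfD.
- by rewrite -[a]piK -equivariant !uE equivariant.
- by rewrite -[a]piK uE vE.
- by rewrite -[a]piK vE uE.
Qed.

Section DupMap.
Variables (M N : bmodType) (f : {additive M -> N}).

Lemma mem_ker_dup_map (x : M * M) :
  (x \in ker_pred (dup_map f)) = (x \in kerp_pred f).
Proof.
rewrite !unfold_in; apply/eqP/eqP => [[]//|e].
exact: (congr2 pair (esym e) e).
Qed.

Lemma isomS_Kerp : isomS (Kerp f) (Ker (dup_map f)).
Proof.
have uP (x : Kerp f) : val x \in ker_pred (dup_map f).
  by rewrite mem_ker_dup_map (valP x).
have vP (x : Ker (dup_map f)) : val x \in kerp_pred f.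
  by rewrite -mem_ker_dup_map (valP x).
pose u x : Ker (dup_map f) := Sub (val x) (uP x).
pose v x : Kerp f := Sub (val x) (vP x).
apply: (@isomS_of_cancel _ _ u v) => [|x|x|x]; last 3 first.
- exact: val_inj.
- exact: val_inj.
- exact: val_inj.
by split=> [|x y]; apply: val_inj.
Qed.

Lemma cokerp_relE (b b' : dup N) :
  cokerp_rel f b b' <-> coker_rel (dup_map f) b b'.
Proof.
split=> [bb'|bb'].
(* By minimality of [cokerp_rel], only the generating pairs need checking. *)
- apply: (bb' (coker_congruence (dup_map f))) => x X g hg.
  have e : dup_map f (x, 0) = s1 (f x) by congr pair; exact: raddf0.
  by have := hg (x, 0); rewrite unfold_in /= e -equivariant => /eqP.
- pose q : {bmodS dup N -> Cokerp f} := qpiS (cokerp_congruenceS f).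
  have qs x : q (s1 (f x)) = q (s2 (f x)) by apply/qpiP => R; apply.
  apply/(qpiP (cokerp_congruence f)); apply: (bb' _ q) => -[x y].
  (* Moving both coordinates into the second factor makes the value symmetric in [u] and [v], hence
     fixed by the involution. *)
  have qE u v : q (f u, f v) = q (s2 (f u)) + q (s2 (f v)).
    rewrite -qs -raddfD; congr (q (_, _)); symmetry.
      exact: addr0.
    exact: add0r.
  rewrite unfold_in -equivariant; apply/eqP.
  exact: etrans (qE y x) (etrans (addrC _ _) (esym (qE x y))).
Qed.

Lemma isomS_Cokerp : isomS (Cokerp f) (Coker (dup_map f)).
Proof. by apply: isomS_quotS => b b'; apply: cokerp_relE. Qed.

End DupMap.

Theorem proposition5p12 (M N : bmodType) (f : {additive M -> N}) :
  isomS (Kerp f) (Ker (dup_map f)) /\ isomS (Cokerp f) (Coker (dup_map f)).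
Proof. by split; [apply: isomS_Kerp | apply: isomS_Cokerp]. Qed.
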